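(* There is a constant $C>0$, independent of $n$ and $\tau$ (but allowed to depend on the fixed data: the mesh, the finite element space, $\mathcal{M}$, $\mathcal{S}$, $U_0$, $F$, $T$), such that the following holds. For every time step $\tau=T/N\in(0,1)$ ($N$ a positive integer) satisfying $$\max\{\tau\|\bm{\mathcal{A}}\|_2,\ \|I-\tau\bm{\mathcal{A}}\|_2\}<1$$ and every $0\le n\le N$, $$\left(\lambda_0(X)-\lambda_0(\bar X_* )\right)^2+\sum_{k=1}^{n}\lambda_k(X)^2\le C\,n^4\tau^2 .$$
   Context: Setting. Let $D\subset\mathbb{R}^d$ ($d=1,2,3$) be a bounded open domain, $T>0$, and let $\alpha(x)=(\alpha_{k,j}(x))_{d\times d}$ be symmetric with entries in $W^{1,\infty}(D)$, $c\in L^\infty(D)$. The underlying problem is $u_t-\nabla\cdot(\alpha\nabla u)+cu=f$ in $D\times(0,T]$ with $u=u_0$ at $t=0$ and $u=0$ on $\partial D\times[0,T]$. Let $\mathbb{V}_h\subset H_0^1(D)$ be a fixed conforming finite element space of standard finite elements of arbitrary order on a fixed shape-regular simplicial mesh of $D$, with interior nodes $x_1,\dots,x_M$ and nodal basis $\varphi_1,\dots,\varphi_M$, $\varphi_k(x_j)=\delta_{kj}$. Write $(\cdot,\cdot)_D$ for the $L^2(D)$ inner product and $a(u,v)=(\alpha\nabla u,\nabla v)_D+(cu,v)_D$. Define the $M\times M$ matrices $\mathcal{M}=((\varphi_k,\varphi_j)_D)$ and $\mathcal{S}=(a(\varphi_k,\varphi_j))$, both symmetric positive definite (standing assumption), and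 the load vector $F=((f,\varphi_1)_D,\dots,(f,\varphi_M)_D)^\top\in\mathbb{R}^M$, which does not depend on the time index. Let $U_0\in\mathbb{R}^M$ be the vector of values at $x_1,\dots,x_M$ of the interpolant of $u_0$ in $\mathbb{V}_h$. With $\tau=T/N$, the vectors $U_1,\dots,U_N\in\mathbb{R}^M$ are defined (backward Euler) by $$(\mathcal{M}+\tau\mathcal{S})U_m=\mathcal{M}U_{m-1}+\tau F,\qquad m=1,\dots,N.$$ Set $\bm{\mathcal{A}}=\mathcal{M}^{-1/2}\mathcal{S}\mathcal{M}^{-1/2}$; $\|\cdot\|_2$ is the spectral norm and $I$ the $M\times M$ identity matrix. For $0\le n\le N$ let $U=(U_0,U_1,\dots,U_n)$ (an $M\times(n+1)$ matrix) and $X=U^\top U$. Define the reference vectors $\bar U_m^*=(1-\tau\|\bm{\mathcal{A}}\|_2)^m U_0$ for $m=0,\dots,n$, and let $\bar U_*=(\bar U_0^*,\dots,\bar U_n^* )$, $\bar X_*=\bar U_*^\top\bar U_*$. For a symmetric $(n+1)\times(n+1)$ matrix $Y$, $\lambda_0(Y)\ge\lambda_1(Y)\ge\dots\ge\lambda_n(Y)$ denote its eigenvalues. *)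

(* Defs.v *)
From HB Require Import structures.
From mathcomp Require Import all_boot all_order all_algebra.
From mathcomp Require Import polyrcf.
From mathcomp Require Import all_classical all_reals all_analysis.

Set Implicit Arguments.
Unset Strict Implicit.
Unset Printing Implicit Defensive.

Import Order.TTheory GRing.Theory Num.Theory.
Import numFieldNormedType.Exports.

Local Open Scope classical_set_scope.
Local Open Scope ring_scope.

(** * Lebesgue measure on the space ['rV[R]_d] of points of R^d *)

(* The product sigma-algebra, generated by the coordinate functions. *)
Section measurable_rV.
Context {R : realType}.
Variable d : nat.

Let coord : 'I_d -> 'rV[R]_d -> R := fun i x => x ord0 i.

Let rV_set0 : g_sigma_preimage coord set0.
Proof. exact: sigma_algebra0. Qed.

Let rV_setC A : g_sigma_preimage coord A -> g_sigma_preimage coord (~` A).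
Proof. exact: sigma_algebraC. Qed.

Let rV_bigcup (F : _^nat) : (forall i, g_sigma_preimage coord (F i)) ->
  g_sigma_preimage coord (\bigcup_i (F i)).
Proof. exact: sigma_algebra_bigcup. Qed.

HB.instance Definition _ := @isMeasurable.Build default_measure_display
  'rV[R]_d (g_sigma_preimage coord) rV_set0 rV_setC rV_bigcup.

Lemma measurable_coord_rV (i : 'I_d) :
  measurable_fun [set: 'rV[R]_d] (fun x : 'rV[R]_d => x ord0 i).
Proof.
move=> _ Y mY; rewrite setTI; apply: sub_sigma_algebra => /=.
rewrite -bigcup_seq/=; exists i => /=; first by rewrite mem_index_enum.
by exists Y => //; rewrite setTI.
Qed.

Lemma measurable_fun_rVP d1 (T1 : measurableType d1) (f : T1 -> 'rV[R]_d) :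
  (forall i, measurable_fun [set: T1] (fun t => f t ord0 i)) ->
  measurable_fun [set: T1] f.
Proof.
move=> mf.
suff : g_sigma_preimage (fun i => coord i \o f) `<=` measurable.
  rewrite g_sigma_preimage_comp => H _ A mA.
  by apply: H; exists A.
apply: smallest_sub; first exact: sigma_algebra_measurable.
rewrite -bigcup_seq; apply: bigcup_sub => i Ii.
by move=> A [B mB <-]; exact: mf.
Qed.

End measurable_rV.

Lemma product_sigma_finite d1 d2 (T1 : measurableType d1)
    (T2 : measurableType d2) (R : realType)
    (m1 : {sigma_finite_measure set T1 -> \bar R})
    (m2 : {sigma_finite_measure set T2 -> \bar R}) :
  sigma_finite setT (m1 \x m2)%E.
Proof.
have /sigma_finiteP[F [TF ndF Foo]] := sigma_finiteT m1.
have /sigma_finiteP[G [TG ndG Goo]] := sigma_finiteT m2.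
exists (fun n => F n `*` G n).
  rewrite -setXTT TF TG predeqE => -[x y]; split.
    move=> [/= [n _ Fnx] [k _ Gky]]; exists (maxn n k) => //; split.
    - by move: x Fnx; exact/subsetPset/ndF/leq_maxl.
    - by move: y Gky; exact/subsetPset/ndG/leq_maxr.
  by move=> [n _ []/= ? ?]; split; exists n.
move=> k; have [? ?] := Foo k; have [? ?] := Goo k.
split; first exact: measurableX.
by rewrite product_measure1E// lte_mul_pinfty// ge0_fin_numE.
Qed.

Definition rV_cons (R : realType) (d : nat) (p : R * 'rV[R]_d) : 'rV[R]_d.+1 :=
  \row_i oapp (fun j => p.2 ord0 j) p.1 (unlift ord0 i).

Section lebesgue_rV_step.
Context {R : realType}.
Variables (d : nat) (mu : {sigma_finite_measure set 'rV[R]_d -> \bar R}).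

Let uncons (x : 'rV[R]_d.+1) : R * 'rV[R]_d :=
  (x ord0 ord0, \row_j x ord0 (lift ord0 j)).

Let rV_consK : cancel (@rV_cons R d) uncons.
Proof.
case=> t x; rewrite /uncons /rV_cons !mxE unlift_none /=; congr pair.
by apply/rowP => j; rewrite !mxE liftK.
Qed.

Lemma measurable_rV_cons :
  measurable_fun [set: measurableTypeR R * 'rV[R]_d] (@rV_cons R d).
Proof.
apply: measurable_fun_rVP => i.
under eq_fun do rewrite mxE.
case: unliftP => [j _|_] /=; last exact: measurable_fst.
exact: (measurableT_comp (measurable_coord_rV j) measurable_snd).
Qed.

Let measurable_uncons :
  measurable_fun [set: 'rV[R]_d.+1]
    (uncons : _ -> measurableTypeR R * 'rV[R]_d).
Proof.
apply: measurable_fun_pair; first exact: measurable_coord_rV.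
apply: measurable_fun_rVP => i.
under eq_fun do rewrite mxE.
exact: measurable_coord_rV.
Qed.

Definition lebesgue_step : set 'rV[R]_d.+1 -> \bar R :=
  pushforward ((@lebesgue_measure R) \x mu)%E (@rV_cons R d).

Let step0 : lebesgue_step set0 = 0%E.
Proof. by rewrite /lebesgue_step /pushforward preimage_set0 measure0. Qed.

Let step_ge0 A : (0 <= lebesgue_step A)%E.
Proof. by apply: integral_ge0 => x _; exact: measure_ge0. Qed.

Let step_sigma_additive : semi_sigma_additive lebesgue_step.
Proof.
pose m := measure_function_pushforward__canonical__measure_function_Measure
  ((@lebesgue_measure R) \x mu)%E measurable_rV_cons.
exact: (@measure_semi_sigma_additive _ _ _ m).
Qed.

HB.instance Definition _ := isMeasure.Build _ _ _ lebesgue_step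
  step0 step_ge0 step_sigma_additive.

Let step_sigma_finite : sigma_finite setT lebesgue_step.
Proof.
have [F TF mF] : sigma_finite setT ((@lebesgue_measure R) \x mu)%E.
  exact: (product_sigma_finite (@lebesgue_measure R) mu).
exists (fun i => uncons @^-1` F i).
  by rewrite -preimage_bigcup -TF preimage_setT.
move=> i; have [mFi Fi] := mF i; split.
  by rewrite -[X in measurable X]setTI; exact: measurable_uncons.
rewrite /lebesgue_step /pushforward -comp_preimage.
by rewrite (_ : uncons \o _ = id) //; apply/funext => p; exact: rV_consK.
Qed.

HB.instance Definition _ :=
  Measure_isSigmaFinite.Build _ _ _ lebesgue_step step_sigma_finite.

End lebesgue_rV_step.

Fixpoint lebesgue_rV (R : realType) (d : nat) :
    {sigma_finite_measure set 'rV[R]_d -> \bar R} :=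
  match d with
  | 0 => [the {sigma_finite_measure set 'rV[R]_0 -> \bar R} of \d_(0 : 'rV[R]_0)]
  | d'.+1 => [the {sigma_finite_measure set 'rV[R]_d'.+1 -> \bar R} of
                lebesgue_step (lebesgue_rV R d')]
  end.

(* [lebesgue_rV] gives coordinate boxes their volume, which characterises
   Lebesgue measure. *)
Lemma lebesgue_rV_box (R : realType) (d : nat) (A : 'I_d -> set R) :
  (forall i, measurable (A i)) ->
  lebesgue_rV R d [set x | forall i, A i (x ord0 i)] =
  (\prod_(i < d) lebesgue_measure (A i))%E.
Proof.
elim: d A => [|d IH] A mA /=.
  by rewrite big_ord0 diracE mem_set // => -[].
rewrite big_ord_recl /lebesgue_step /pushforward.
have mB : measurable [set x : 'rV[R]_d | forall i, A (lift ord0 i) (x ord0 i)].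
  rewrite (_ : [set x | _] =
      \bigcap_(i in [set: 'I_d]) ((fun x : 'rV[R]_d => x ord0 i) @^-1`
        A (lift ord0 i))); last first.
    by apply/seteqP; split => x /= h i; [move=> _; exact: h | exact: (h i)].
  apply: fin_bigcap_measurable => // i _.
  by rewrite -[X in measurable X]setTI; exact: measurable_coord_rV.
rewrite -(IH (fun i => A (lift ord0 i))) //.
rewrite -(product_measure1E (@lebesgue_measure R) (lebesgue_rV R d)) //;
  last exact: mA.
congr (product_measure1 _ _ _).
apply/seteqP; split => -[t x] /=; rewrite /rV_cons /=.
  move=> h; split => [|i]; first by have := h ord0; rewrite mxE unlift_none.
  by have := h (lift ord0 i); rewrite mxE liftK.
by move=> [h0 h] i; rewrite mxE; case: unliftP => [j ->|->] //=; exact: h.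
Qed.

(** * Function spaces and derivatives on an open set *)

Section function_spaces.
Context {R : realType} {d : nat}.
Implicit Types (D : set 'rV[R]_d) (u v g psi : 'rV[R]_d -> R).

Definition bounded_domain D : Prop :=
  [/\ open D, connected D, D !=set0 & bounded_set D].

Definition dotL2 D u v : R := \int[lebesgue_rV R d]_(x in D) (u x * v x).

Definition inL2 D u : Prop :=
  measurable_fun D u /\
  (lebesgue_rV R d).-integrable D (EFin \o (fun x => u x ^+ 2)).

Definition inLinf D u : Prop :=
  measurable_fun D u /\
  exists K : R, {ae lebesgue_rV R d, forall x, D x -> `|u x| <= K}.

Definition partial (i : 'I_d) u : 'rV[R]_d -> R :=
  fun x => 'D_(delta_mx ord0 i) u x.

Definition grad u (x : 'rV[R]_d) : 'cV[R]_d := \col_i partial i u x.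

Definition iter_partial (s : seq 'I_d) u : 'rV[R]_d -> R :=
  foldr partial u s.

Definition smooth u : Prop :=
  forall s : seq 'I_d, continuous (iter_partial s u) /\
    forall x i, derivable (iter_partial s u) x (delta_mx ord0 i).

Definition test_function D psi : Prop :=
  smooth psi /\
  exists K, [/\ compact K, K `<=` D & forall x, ~ K x -> psi x = 0].

Definition weak_partial D (i : 'I_d) u g : Prop :=
  forall psi, test_function D psi ->
    dotL2 D u (partial i psi) = - dotL2 D g psi.

Definition inW1inf D u : Prop :=
  inLinf D u /\ forall i, exists g, inLinf D g /\ weak_partial D i u g.

(* The bilinear form a(u,v) = (alpha grad u, grad v)_D + (c u, v)_D.  The
   gradients are the classical ones; for continuous piecewise polynomials they
   exist outside a null set and agree with the weak gradients. *)
Definition bilinear_form D (alpha : 'rV[R]_d -> 'M[R]_d) (c u v : 'rV[R]_d -> R)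
    : R :=
  \int[lebesgue_rV R d]_(x in D)
    (\sum_(i < d) (alpha x *m grad u x) i ord0 * grad v x i ord0)
  + dotL2 D (fun x => c x * u x) v.

End function_spaces.

(** * Lagrange finite elements on a simplicial mesh *)

Section finite_elements.
Context {R : realType} {d : nat}.
Implicit Types (D S : set 'rV[R]_d) (K : 'I_d.+1 -> 'rV[R]_d).
Implicit Types (v : 'rV[R]_d -> R).

Definition conv_hull S : set 'rV[R]_d :=
  [set x | exists (n : nat) (p : 'I_n -> 'rV[R]_d) (w : 'I_n -> R),
    [/\ forall i, S (p i), forall i, 0 <= w i, \sum_i w i = 1
      & x = \sum_i w i *: p i]].

(* A simplex is given by its [d + 1] vertices. *)
Definition simplex K : set 'rV[R]_d := conv_hull (range K).

Definition affine_independent K : Prop :=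
  \matrix_(i < d) (K (lift ord0 i) - K ord0) \in unitmx.

(* The empty hull is allowed: two simplices may be disjoint. *)
Definition simplicial_mesh D (L : nat) (mesh : 'I_L -> 'I_d.+1 -> 'rV[R]_d)
    : Prop :=
  [/\ forall l, affine_independent (mesh l),
      closure D = \bigcup_(l in [set: 'I_L]) simplex (mesh l)
    & forall l l', l != l' ->
        range (mesh l) <> range (mesh l') /\
        simplex (mesh l) `&` simplex (mesh l') =
          conv_hull (range (mesh l) `&` range (mesh l'))].

Definition poly_degree_le (r : nat) v (S : set 'rV[R]_d) : Prop :=
  exists a : {ffun 'I_d -> 'I_r.+1} -> R, forall x, S x ->
    v x = \sum_(m : {ffun 'I_d -> 'I_r.+1} | (\sum_i m i <= r)%N)
            a m * \prod_(i < d) x ord0 i ^+ m i.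

Definition fe_space D L (mesh : 'I_L -> 'I_d.+1 -> 'rV[R]_d) (r : nat)
    : set ('rV[R]_d -> R) :=
  [set v | [/\ {within closure D, continuous v},
               forall l, poly_degree_le r v (simplex (mesh l))
             & forall x, closure D x -> ~ D x -> v x = 0]].

(* The principal lattice of order [r] of a simplex. *)
Definition lagrange_points (r : nat) K : set 'rV[R]_d :=
  [set x | exists b : 'I_d.+1 -> nat,
    (\sum_i b i)%N = r /\ x = \sum_i ((b i)%:R / r%:R) *: K i].

Definition interior_nodes D L (mesh : 'I_L -> 'I_d.+1 -> 'rV[R]_d) (r M : nat)
    (node : 'I_M -> 'rV[R]_d) : Prop :=
  injective node /\
  range node =
    D `&` \bigcup_(l in [set: 'I_L]) lagrange_points r (mesh l).

Definition nodal_basis D (V : set ('rV[R]_d -> R)) (M : nat)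
    (node : 'I_M -> 'rV[R]_d) (phi : 'I_M -> 'rV[R]_d -> R) : Prop :=
  [/\ forall k, V (phi k),
      forall k j, phi k (node j) = (k == j)%:R
    & forall v, V v -> forall x, closure D x ->
        v x = \sum_k v (node k) * phi k x].

Definition interpolant (M : nat) (node : 'I_M -> 'rV[R]_d)
    (phi : 'I_M -> 'rV[R]_d -> R) v : 'rV[R]_d -> R :=
  fun x => \sum_k v (node k) * phi k x.

Definition mass_matrix D (M : nat) (phi : 'I_M -> 'rV[R]_d -> R) : 'M[R]_M :=
  \matrix_(k, j) dotL2 D (phi k) (phi j).

Definition stiffness_matrix D (alpha : 'rV[R]_d -> 'M[R]_d)
    (c : 'rV[R]_d -> R) (M : nat) (phi : 'I_M -> 'rV[R]_d -> R) : 'M[R]_M :=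
  \matrix_(k, j) bilinear_form D alpha c (phi k) (phi j).

Definition load_vector D (f : 'rV[R]_d -> R) (M : nat)
    (phi : 'I_M -> 'rV[R]_d -> R) : 'cV[R]_M :=
  \col_k dotL2 D f (phi k).

End finite_elements.

(** * Matrices *)

Section matrices.
Context {R : realType}.

Definition posdefmx (n : nat) (A : 'M[R]_n) : Prop :=
  A^T = A /\
  forall x : 'cV[R]_n, x != 0 -> 0 < (x^T *m A *m x) ord0 ord0.

(* The unique positive definite square root of a positive definite matrix. *)
Definition sqrtmx (n : nat) (A : 'M[R]_n) : 'M[R]_n :=
  xget 0 [set B | posdefmx B /\ B *m B = A].

Definition invsqrtmx (n : nat) (A : 'M[R]_n) : 'M[R]_n := invmx (sqrtmx A).

Definition l2norm (n : nat) (x : 'cV[R]_n) : R :=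
  Num.sqrt (\sum_i x i ord0 ^+ 2).

Definition spectral_norm (n : nat) (A : 'M[R]_n) : R :=
  sup [set l2norm (A *m x) | x in [set x : 'cV[R]_n | l2norm x <= 1]].

(* The real eigenvalues, repeated according to their multiplicity as roots of
   the characteristic polynomial, in nonincreasing order. *)
Definition eigenvalues (n : nat) (A : 'M[R]_n) : seq R :=
  sort (fun a b => b <= a)
    (flatten [seq nseq (mup a (char_poly A)) a | a <- rootsR (char_poly A)]).

Definition eigval (k : nat) (n : nat) (A : 'M[R]_n) : R :=
  nth 0 (eigenvalues A) k.

Definition backward_euler (M : nat) (Mm Sm : 'M[R]_M) (F : 'cV[R]_M) (tau : R)
    (N : nat) (U : nat -> 'cV[R]_M) : Prop :=
  forall m, (1 <= m <= N)%N ->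
    (Mm + tau *: Sm) *m U m = Mm *m U m.-1 + tau *: F.

(* The matrix with columns U_0, ..., U_n. *)
Definition snapshots (M : nat) (U : nat -> 'cV[R]_M) (n : nat)
    : 'M[R]_(M, n.+1) :=
  \matrix_(i < M, m < n.+1) U m i ord0.

Definition gram (M : nat) (U : nat -> 'cV[R]_M) (n : nat) : 'M[R]_n.+1 :=
  (snapshots U n)^T *m snapshots U n.

End matrices.

(* Main.v *)
(** Entrywise, X and the reference matrix X* are O(n tau) apart: in the
    M-energy norm the increments U_{m+1} - U_m do not grow, the first one being
    O(tau), and Bernoulli's inequality controls (1 - tau |A|)^m.  Hence
    |X - X*|_F^2 = O(n^4 tau^2).  As X* = w w^T has rank one, the left-hand side
    is the Hoffman-Wielandt sum of X and X*, and in this case the inequality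
    only needs sum_k lambda_k(X)^2 = tr X^2 and the Rayleigh bound
    w^T X w <= lambda_0(X) |w|^2. *)

Require Import Defs.
From mathcomp Require Import all_boot all_order all_algebra.
From mathcomp Require Import polyrcf complex.
From mathcomp Require Import all_classical all_reals all_analysis.
From mathcomp Require Import ring lra.

Set Implicit Arguments.
Unset Strict Implicit.
Unset Printing Implicit Defensive.

Import Order.TTheory GRing.Theory Num.Theory.
Import numFieldNormedType.Exports.

Local Open Scope classical_set_scope.
Local Open Scope ring_scope.

(** * Eigenvalues of real symmetric matrices *)

Lemma char_poly_similar (K : fieldType) (n : nat) (P A : 'M[K]_n) :
  P \in unitmx -> char_poly (invmx P *m A *m P) = char_poly A.
Proof.
move=> uP; rewrite /char_poly.
have -> : char_poly_mx (invmx P *m A *m P) =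
    map_mx (@polyC K) (invmx P) *m char_poly_mx A *m map_mx (@polyC K) P.
  rewrite /char_poly_mx mulmxBr mulmxBl -!map_mxM /=; congr (_ - _).
  by rewrite scalar_mxC -mulmxA -map_mxM mulVmx // map_mx1 mulmx1.
rewrite !det_mulmx mulrAC -det_mulmx -map_mxM mulVmx //.
by rewrite map_mx1 det1 mul1r.
Qed.

Local Notation toC := (real_complex _).

(* [w i] is the squared modulus of the i-th coordinate of [x] in a unitary
   eigenbasis over [R[i]]. *)
Lemma symmetric_spectral (R : rcfType) (n : nat) (A : 'M[R]_n) : A^T = A ->
  exists l : 'I_n -> R,
    [/\ char_poly A = \prod_i ('X - (l i)%:P),
        \tr (A *m A) = \sum_i l i ^+ 2
      & forall x : 'cV[R]_n, exists w : 'I_n -> R,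
          [/\ forall i, 0 <= w i, \sum_i w i = \sum_i x i ord0 ^+ 2
            & (x^T *m A *m x) ord0 ord0 = \sum_i l i * w i]].
Proof.
move=> symA.
(* Over [R[i]] the matrix is Hermitian, so the complex spectral theorem diagonalises it by a unitary
   [P]; its eigenvalues are real, hence [l] loses nothing by taking real parts. *)
pose B : 'M[R[i]]_n := map_mx toC A.
have hermB : B \is hermsymmx.
  apply: realsym_hermsym.
    by apply/is_hermitianmxP; rewrite expr0 scale1r map_mx_id // map_trmx symA.
  by apply/mxOverP => i j; rewrite mxE; apply/complex_realP; exists (A i j).
have /hermitian_normalmx/orthomx_spectralP := hermB.
have /mxOverP := hermitian_spectral_diag_real hermB.
have := spectral_unitarymx B.
move: (spectralmx B) (spectral_diag B) => P D unP realD defB.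
have uP := unitarymx_unit unP.
pose l i := complex.Re (D ord0 i).
have lE i : D ord0 i = toC (l i) by rewrite RRe_real.
exists l; split.
- apply: (map_poly_inj toC); rewrite map_char_poly -/B defB.
  rewrite char_poly_similar //.
  rewrite char_poly_trig ?diag_mx_is_trig // rmorph_prod /=.
  by apply: eq_bigr => i _; rewrite map_polyXsubC mxE eqxx mulr1n lE.
- apply: (@complexI R).
  rewrite -trace_map_mx map_mxM -/B {1 2}defB.
  rewrite !mulmxA mulmxK // mxtrace_mulC !mulmxA mulmxV // mul1mx mulmx_diag.
  rewrite mxtrace_diag rmorph_sum; apply: eq_bigr => i _.
  by rewrite mxE lE rmorphXn.
move=> x; pose xC := map_mx toC x.
have [y yE] : {y | y = P *m xC} by exists (P *m xC).
exists (fun i => complex.Re (y i ord0 * (y i ord0)^*)).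
have wE i : toC (complex.Re (y i ord0 * (y i ord0)^*)) =
    y i ord0 * (y i ord0)^*.
  by rewrite RRe_real // ger0_real // mul_conjC_ge0.
have conj_xC : map_mx Num.conj xC = xC.
  apply/matrixP => i j; rewrite !mxE; apply/CrealP/complex_realP; by eexists.
(* As [P] is unitary and [x] is real, this row is the conjugate transpose of [y]. The squared norm
   and the quadratic form of [x] thus become sums over the coordinates of [y]. *)
have yC : xC^T *m invmx P = (map_mx Num.conj y)^T.
  by rewrite invmx_unitary // -map_trmx yE map_mxM trmx_mul conj_xC.
split=> [i||].
- by rewrite -lecR -[0 as X in X <= _]/(toC 0) wE mul_conjC_ge0.
- apply: (@complexI R); rewrite !rmorph_sum /=.
  under eq_bigr => i _ do rewrite wE.
  have -> : \sum_i y i ord0 * (y i ord0)^* =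
      ((map_mx Num.conj y)^T *m y) ord0 ord0.
    by rewrite mxE; apply: eq_bigr => i _; rewrite !mxE mulrC.
  rewrite -yC yE mulmxA mulmxKV // mxE; apply: eq_bigr => i _.
  by rewrite !mxE rmorphXn expr2.
apply: (@complexI R); rewrite rmorph_sum /=.
have -> : toC ((x^T *m A *m x) ord0 ord0) = (xC^T *m B *m xC) ord0 ord0.
  by rewrite /xC /B map_trmx -!map_mxM [RHS]mxE.
rewrite defB !mulmxA yC -mulmxA -yE mxE; apply: eq_bigr => i _.
rewrite mul_mx_diag !mxE rmorphM /= wE lE; ring.
Qed.

(** Both lists contain each [a] as often as its multiplicity as a root of the characteristic
    polynomial: [rootsR] lists every root once, so exactly one block of the flattened list consists
    of copies of a given root. *)
Lemma perm_eigenvalues (R : realType) (n : nat) (A : 'M[R]_n) (l : 'I_n -> R) :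
  char_poly A = \prod_i ('X - (l i)%:P) -> perm_eq (eigenvalues A) (codom l).
Proof.
move=> chA; rewrite /eigenvalues perm_sort; apply/allP => a _ /=; apply/eqP.
have <- : mup a (char_poly A) = count_mem a (codom l).
  rewrite chA -[RHS](mu_prod_XsubC a (codom l)); congr mup.
  by rewrite codomE big_map big_enum.
have chA0 : char_poly A != 0 by rewrite monic_neq0 // char_poly_monic.
rewrite count_flatten -map_comp sumnE big_map.
under eq_bigr => b _ do rewrite /= count_nseq /=.
have memE : (a \in rootsR (char_poly A)) = root (char_poly A) a.
  by rewrite -(roots_on_rootsR chA0) in_itv.
have [ra|nra] := boolP (root (char_poly A) a); last first.
  rewrite mupNroot // big1_seq // => b /andP[_ bA].
  case: eqVneq => [ba|]; last by rewrite mul0n.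
  by move: bA; rewrite ba memE (negPf nra).
rewrite (bigD1_seq a) ?memE ?uniq_roots //= eqxx mul1n big1 ?addn0 // => b ba.
by rewrite (negPf ba) mul0n.
Qed.

Lemma eigval_sum_sqr (R : realType) (n : nat) (A : 'M[R]_n.+1) : A^T = A ->
  \sum_(k < n.+1) eigval k A ^+ 2 = \tr (A *m A).
Proof.
move=> /symmetric_spectral[l [/perm_eigenvalues permA -> _]].
(* Full splitting of the characteristic polynomial gives exactly [n.+1] entries, so [eigval] never
   returns the default [0] of [nth] in this sum. *)
have szA : size (eigenvalues A) = n.+1.
  by rewrite (perm_size permA) size_codom card_ord.
transitivity (\sum_(a <- eigenvalues A) a ^+ 2).
  by rewrite [RHS](big_nth 0) szA big_mkord.
by rewrite (perm_big _ permA) codomE big_map big_enum.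
Qed.

(** In an eigenbasis the form is a sum of eigenvalues with nonnegative weights of total [|x|^2], and
    the head of the sorted list dominates every eigenvalue. *)
Lemma rayleigh_eigval0 (R : realType) (n : nat) (A : 'M[R]_n) (x : 'cV[R]_n) :
  A^T = A ->
  (x^T *m A *m x) ord0 ord0 <= eigval 0 A * \sum_i x i ord0 ^+ 2.
Proof.
move=> /symmetric_spectral[l [/perm_eigenvalues permA _ /(_ x)]].
move=> [w [w_ge0 <- ->]]; rewrite mulr_sumr ler_sum // => i _.
apply: ler_wpM2r => //.
have : l i \in eigenvalues A by rewrite (perm_mem permA) codom_f.
have : sorted (fun a b : R => b <= a) (eigenvalues A).
  by apply: sort_sorted => a b; exact: le_total.
rewrite /eigval; case: (eigenvalues A) => //= a s.
rewrite path_sortedE => [/andP[/allP as_ _]|a1 a2 a3 h1 h2]; last first.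
  exact: le_trans h2 h1.
by rewrite in_cons => /predU1P[->//|/as_].
Qed.

(** * Hoffman-Wielandt inequality against a rank-one matrix *)

Lemma quad_formE (R : realType) (n : nat) (A : 'M[R]_n) (w : 'cV[R]_n) :
  (w^T *m A *m w) ord0 ord0 = \sum_i \sum_j A i j * (w i ord0 * w j ord0).
Proof.
rewrite -mulmxA mxE; apply: eq_bigr => i _.
by rewrite !mxE mulr_sumr; apply: eq_bigr => j _; ring.
Qed.

Lemma outer_product_sym (R : realType) (n : nat) (w : 'cV[R]_n) :
  (w *m w^T)^T = w *m w^T.
Proof. by rewrite trmx_mul trmxK. Qed.

Lemma mxtrace_sqr_sym (R : realType) (n : nat) (A : 'M[R]_n) : A^T = A ->
  \tr (A *m A) = \sum_i \sum_j A i j ^+ 2.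
Proof.
move=> symA; apply: eq_bigr => i _; rewrite mxE; apply: eq_bigr => j _.
by rewrite -{2}symA mxE expr2.
Qed.

(** With [s = |w|^2], the Rayleigh bound at [w] gives [s^2 <= lambda_0 * s], while the trace of the
    square, equal to [s^2], gives [lambda_0^2 <= s^2]. For [s != 0] these pinch [lambda_0] to [s];
    for [s = 0] the second suffices. *)
Lemma eigval0_rank_one (R : realType) (n : nat) (w : 'cV[R]_n.+1) :
  eigval 0 (w *m w^T) = \sum_i w i ord0 ^+ 2.
Proof.
set s := \sum_i w i ord0 ^+ 2; set A := w *m w^T.
have AE i j : A i j = w i ord0 * w j ord0 by rewrite mxE big_ord1 mxE.
have s_ge0 : 0 <= s by apply: sumr_ge0 => i _; exact: sqr_ge0.
have sumA : \sum_i \sum_j A i j * (w i ord0 * w j ord0) = s ^+ 2.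
  rewrite expr2 big_distrlr /=; apply: eq_bigr => i _; apply: eq_bigr => j _.
  by rewrite AE; ring.
have ray := rayleigh_eigval0 w (outer_product_sym w).
rewrite quad_formE sumA -/s in ray.
have trA : \tr (A *m A) = s ^+ 2.
  rewrite mxtrace_sqr_sym ?outer_product_sym // -sumA.
  by apply: eq_bigr => i _; apply: eq_bigr => j _; rewrite expr2 AE.
have := eigval_sum_sqr (outer_product_sym w).
rewrite -/A trA big_ord_recl /= => tr.
have le2 : eigval 0 A ^+ 2 <= s ^+ 2.
  by rewrite -tr lerDl; apply: sumr_ge0 => i _; exact: sqr_ge0.
have les : eigval 0 A <= s.
  apply: le_trans (ler_norm _) _.
  by rewrite -(ler_pXn2r (n := 2)) ?nnegrE // real_normK ?num_real.
have [s0|s_neq0] := eqVneq s 0; last first.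
  apply/eqP; rewrite eq_le les /= -(ler_pM2r (x := s)) -?expr2 //.
  by rewrite lt_def s_neq0.
move: le2; rewrite s0 expr0n /= => le2.
by apply/eqP; rewrite -sqrf_eq0 eq_le le2 sqr_ge0.
Qed.

(* Expanding the squares, the inequality is <A, w w^T> <= lambda_0(A) |w|^2,
   which is the Rayleigh bound at w. *)
Lemma hoffman_wielandt_rank_one (R : realType) (n : nat) (A : 'M[R]_n.+1)
    (w : 'cV[R]_n.+1) : A^T = A ->
  (eigval 0 A - eigval 0 (w *m w^T)) ^+ 2 + \sum_(1 <= k < n.+1) eigval k A ^+ 2
    <= \sum_i \sum_j (A i j - w i ord0 * w j ord0) ^+ 2.
Proof.
move=> symA; rewrite eigval0_rank_one; set s := \sum_i w i ord0 ^+ 2.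
have := eigval_sum_sqr symA; rewrite mxtrace_sqr_sym //.
rewrite -(big_mkord xpredT (fun k => eigval k A ^+ 2)).
rewrite big_ltn // => trA.
have := rayleigh_eigval0 w symA; rewrite quad_formE -/s => ray.
have s2 : \sum_i \sum_j (w i ord0 * w j ord0) ^+ 2 = s ^+ 2.
  rewrite expr2 big_distrlr /=; apply: eq_bigr => i _; apply: eq_bigr => j _.
  by rewrite exprMn.
have -> : \sum_i \sum_j (A i j - w i ord0 * w j ord0) ^+ 2 =
    \sum_i \sum_j A i j ^+ 2
      - 2 * (\sum_i \sum_j A i j * (w i ord0 * w j ord0)) + s ^+ 2.
  rewrite -s2 mulr_sumr -sumrB -big_split /=; apply: eq_bigr => i _.
  rewrite mulr_sumr -sumrB -big_split /=; apply: eq_bigr => j _. ring.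
rewrite -trA; lra.
Qed.

(** * Energy estimates for backward Euler steps *)

Lemma posdefmx_unit (R : realType) (n : nat) (A : 'M[R]_n) :
  posdefmx A -> A \in unitmx.
Proof.
move=> [symA posA]; rewrite unitmxE unitfE; apply/negP => /eqP detA.
have /det0P[v v0 vA] : \det A == 0 by rewrite detA.
have : v^T != 0 by rewrite trmx_eq0.
by move=> /posA; rewrite trmxK vA mul0mx mxE ltxx.
Qed.

Section energy_form.
Context {R : realType} {n : nat} (A : 'M[R]_n).
Implicit Types x y z : 'cV[R]_n.

Definition mxform x y : R := (x^T *m A *m y) ord0 ord0.

Lemma mxformDr x y z : mxform x (y + z) = mxform x y + mxform x z.
Proof. by rewrite /mxform mulmxDr mxE. Qed.

Lemma mxformZr a x y : mxform x (a *: y) = a * mxform x y.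
Proof. by rewrite /mxform -scalemxAr mxE. Qed.

Hypothesis posA : posdefmx A.

Lemma mxformC x y : mxform x y = mxform y x.
Proof.
have /matrixP/(_ ord0 ord0) : (x^T *m A *m y)^T = y^T *m A *m x.
  by rewrite !trmx_mul trmxK posA.1 mulmxA.
by rewrite mxE.
Qed.

Lemma mxform_gt0 x : x != 0 -> 0 < mxform x x.
Proof. exact: posA.2. Qed.

Lemma mxform_ge0 x : 0 <= mxform x x.
Proof.
have [->|/mxform_gt0/ltW//] := eqVneq x 0.
by rewrite /mxform mulmx0 mxE.
Qed.

Lemma mxform_cauchy_schwarz x y : mxform x y ^+ 2 <= mxform x x * mxform y y.
Proof.
have [->|/mxform_gt0 y_gt0] := eqVneq y 0.
  by rewrite /mxform !mulmx0 mxE expr0n mulr0.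
(* This is [(y,y)] times the residual of projecting [x] on [y], scaled to avoid a division; the
   surplus factor [(y,y) > 0] is cancelled at the end. *)
have := mxform_ge0 (mxform y y *: x + (- mxform x y) *: y).
set z := (X in mxform X X); rewrite {2}/z mxformDr !mxformZr.
rewrite (mxformC z x) (mxformC z y) !mxformDr !mxformZr (mxformC y x) => h.
have {h} : 0 <= mxform y y * (mxform x x * mxform y y - mxform x y ^+ 2).
  apply: le_trans h _; rewrite le_eqVlt; apply/orP; left; apply/eqP; ring.
by rewrite pmulr_rge0 // subr_ge0.
Qed.

(** Riesz representation of a coordinate functional: with Cauchy-Schwarz it turns energy bounds into
    entrywise bounds. *)
Lemma mxform_coord x k :
  x k ord0 = mxform (invmx A *m delta_mx k ord0) x.
Proof.
have uA := posdefmx_unit posA.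
rewrite mxformC /mxform -!mulmxA mulKVmx // [in RHS]mxE (bigD1 k) //= big1.
  by rewrite !mxE !eqxx mulr1 addr0.
by move=> i ik; rewrite [X in _ * X]mxE (negPf ik) mulr0.
Qed.

(** Testing the equation with [x] gives [(x,x) + t x^T B x = (x,z)]. The second term is nonnegative,
    and Cauchy-Schwarz bounds the right-hand side. *)
Lemma mxform_decay (B : 'M[R]_n) (t : R) x z : posdefmx B -> 0 <= t ->
  (A + t *: B) *m x = A *m z -> mxform x x <= mxform z z.
Proof.
move=> posB t_ge0 xz.
have xBx : 0 <= (x^T *m B *m x) ord0 ord0.
  have [->|/posB.2/ltW//] := eqVneq x 0.
  by rewrite mulmx0 mxE.
have le_xz : mxform x x <= mxform x z.
  have -> : mxform x z = mxform x x + t * (x^T *m B *m x) ord0 ord0.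
    rewrite /mxform -!mulmxA -xz mulmxDl mulmxDr -scalemxAl -scalemxAr mxE.
    by congr (_ + _); rewrite mxE.
  by rewrite lerDl mulr_ge0.
have [x0|x_gt0] := leP (mxform x x) 0; first exact: le_trans x0 (mxform_ge0 z).
rewrite -(ler_pM2l x_gt0) -expr2; apply: le_trans (mxform_cauchy_schwarz x z).
have xz_ge0 := ltW (lt_le_trans x_gt0 le_xz).
by rewrite ler_pXn2r // nnegrE // ltW.
Qed.

End energy_form.

(* The increments solve the same scheme without load, so their energy norm
   decreases from the first one, which is O(tau). *)
Lemma backward_euler_drift (R : realType) (M : nat) (Mm Sm : 'M[R]_M)
    (F U0 : 'cV[R]_M) : posdefmx Mm -> posdefmx Sm ->
  exists2 K : R, 0 <= K &
    forall (tau : R) (N : nat) (U : nat -> 'cV[R]_M), 0 <= tau ->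
      U 0%N = U0 -> backward_euler Mm Sm F tau N U ->
      forall m k, (m <= N)%N ->
        `|U m k ord0 - U0 k ord0| <= K * (m%:R * tau).
Proof.
move=> posM posS; have uM := posdefmx_unit posM.
(* Subtracting [(Mm + tau Sm) U0] from the first step leaves [tau (F - Sm U0) = Mm (tau g)], so the
   first increment has energy at most [tau^2 (g,g)]. *)
pose g := invmx Mm *m (F - Sm *m U0).
(* [c k] represents the k-th coordinate; [G] dominates the energies of all of them, so one constant
   serves every coordinate. *)
pose c k := invmx Mm *m (delta_mx k ord0 : 'cV[R]_M).
pose G := \sum_k mxform Mm (c k) (c k).
have G_ge0 : 0 <= G by apply: sumr_ge0 => k _; exact: mxform_ge0.
exists (Num.sqrt (G * mxform Mm g g)) => [|tau N U tau_ge0 U0E beU].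
  exact: sqrtr_ge0.
set K := Num.sqrt _.
have K2 : K ^+ 2 = G * mxform Mm g g.
  by rewrite sqr_sqrtr // mulr_ge0 // mxform_ge0.
pose W m := U m.+1 - U m.
have W0 : (0 < N)%N -> (Mm + tau *: Sm) *m W 0%N = Mm *m (tau *: g).
  move=> N_gt0; rewrite /W mulmxBr (beU 1%N) //= U0E mulmxDl.
  rewrite -scalemxAl -scalemxAr mulKVmx // scalerBr.
  by apply/matrixP => i j; rewrite !mxE; ring.
have WS m : (m.+1 < N)%N -> (Mm + tau *: Sm) *m W m.+1 = Mm *m W m.
  move=> mN; rewrite /W mulmxBr (beU m.+2) // (beU m.+1) ?(ltnW mN) //= mulmxBr.
  by rewrite opprD addrACA subrr addr0.
have eW m : (m < N)%N -> mxform Mm (W m) (W m) <= tau ^+ 2 * mxform Mm g g.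
  elim: m => [|m IH] mN.
    have := mxform_decay posM posS tau_ge0 (W0 mN).
    by rewrite mxformZr mxformC // mxformZr mulrA -expr2.
  by apply: le_trans (IH (ltnW mN)); exact: mxform_decay (WS m mN).
have cW m k : (m < N)%N -> `|W m k ord0| <= K * tau.
  move=> mN; rewrite -(@ler_pXn2r _ 2) ?nnegrE ?mulr_ge0 ?sqrtr_ge0 //.
  rewrite real_normK ?num_real // (mxform_coord posM) exprMn K2.
  apply: le_trans (mxform_cauchy_schwarz posM _ _) _.
  rewrite -mulrA [_ * tau ^+ 2]mulrC.
  apply: ler_pM; rewrite ?mxform_ge0 //; last exact: eW.
  by rewrite /G (bigD1 k) //= lerDl; apply: sumr_ge0 => i _; exact: mxform_ge0.
move=> m k; elim: m => [|m IH] mN.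
  by rewrite U0E subrr normr0 !mul0r mulr0.
have -> : U m.+1 k ord0 - U0 k ord0 = W m k ord0 + (U m k ord0 - U0 k ord0).
  by rewrite !mxE; ring.
apply: le_trans (ler_normD _ _) _.
apply: le_trans (lerD (cW m k mN) (IH (ltnW mN))) _.
by rewrite -[X in X + _]mul1r -[m.+1]addn1 natrD; lra.
Qed.

(** * Entrywise comparison of the Gram matrices *)

Lemma gramE (R : realType) (M : nat) (U : nat -> 'cV[R]_M) (n : nat) i j :
  gram U n i j = \sum_k U i k ord0 * U j k ord0.
Proof. by rewrite mxE; apply: eq_bigr => k _; rewrite !mxE. Qed.

Lemma spectral_norm_ge0 (R : realType) (n : nat) (A : 'M[R]_n) :
  0 <= spectral_norm A.
Proof.
rewrite /spectral_norm; set S := (X in sup X).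
have S0 : S 0.
  exists 0 => /=; rewrite ?mulmx0 /l2norm big1 ?sqrtr0 ?ler01 // => i _.
    by rewrite mxE expr0n.
  by rewrite mxE expr0n.
(* Without a supremum, [sup] takes the default value [0]. *)
have [supS|/sup_out->//] := pselect (has_sup S).
by apply: ub_le_sup => //; case: supS.
Qed.

(** Bernoulli's inequality, applied below to [q = 1 - tau * s] to measure how far the reference
    vectors move from [U0]. *)
Lemma subr1_exp_le (R : realDomainType) (q : R) (i : nat) :
  0 <= q <= 1 -> 0 <= 1 - q ^+ i <= i%:R * (1 - q).
Proof.
move=> /andP[q_ge0 q_le1]; elim: i => [|i /andP[IH0 IH]].
  by rewrite expr0 subrr mul0r lexx.
rewrite subr_ge0 exprn_ile1 //= exprS -[i.+1]addn1 natrD mulrDl mul1r.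
have -> : 1 - q * q ^+ i = (1 - q ^+ i) * q + (1 - q) by ring.
by rewrite lerD2r; apply: le_trans IH; rewrite ler_piMr.
Qed.

Lemma dist_mul_le (R : realDomainType) (x y x' y' e a : R) :
  `|x - x'| <= e -> `|y - y'| <= e -> `|x'| <= a -> `|y| <= a ->
  `|x * y - x' * y'| <= e * (2 * a).
Proof.
move=> xx' yy' x'a ya.
have -> : x * y - x' * y' = (x - x') * y + x' * (y - y') by ring.
apply: le_trans (ler_normD _ _) _; rewrite !normrM.
have h1 : `|x - x'| * `|y| <= e * a by apply: ler_pM.
have h2 : `|x'| * `|y - y'| <= a * e by apply: ler_pM.
by apply: le_trans (lerD h1 h2) _; rewrite mulrC; lra.
Qed.

(** Iterates and reference vectors both stay within [O(n tau)] of [U0], and both are bounded up to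
    time [T]; products of entries inherit the [O(n tau)] distance. *)
Lemma gram_deviation (R : realType) (M : nat) (Mm Sm : 'M[R]_M)
    (F U0 : 'cV[R]_M) (T s : R) :
  posdefmx Mm -> posdefmx Sm -> 0 <= T -> 0 <= s ->
  exists2 B : R, 0 <= B &
    forall (tau : R) (N : nat) (U : nat -> 'cV[R]_M),
      0 <= tau -> tau * s <= 1 -> N%:R * tau <= T ->
      U 0%N = U0 -> backward_euler Mm Sm F tau N U ->
      forall n, (n <= N)%N -> forall i j,
        `|gram U n i j - gram (fun m => (1 - tau * s) ^+ m *: U0) n i j|
          <= B * (n%:R * tau).
Proof.
move=> posM posS T_ge0 s_ge0.
have [K K_ge0 drift] := backward_euler_drift F U0 posM posS.
(* [c k] adds the drift rate [K] of the iterates to the rate of the reference vectors; [a k] bounds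
   the k-th entries of both up to time [T]. *)
pose c k := K + s * `|U0 k ord0|.
pose a k := `|U0 k ord0| + K * T.
have c_ge0 k : 0 <= c k by rewrite addr_ge0 // mulr_ge0.
have a_ge0 k : 0 <= a k by rewrite addr_ge0 // mulr_ge0.
exists (\sum_k c k * (2 * a k)).
  by apply: sumr_ge0 => k _; rewrite !mulr_ge0.
move=> tau N U tau_ge0 taus NT U0E beU n nN i j.
have ntau_ge0 : 0 <= n%:R * tau by rewrite mulr_ge0.
have ntauT : n%:R * tau <= T.
  by apply: le_trans NT; rewrite ler_wpM2r // ler_nat.
have q01 : 0 <= 1 - tau * s <= 1 by rewrite subr_ge0 taus gerBl mulr_ge0.
have driftn (m : 'I_n.+1) k : `|U m k ord0 - U0 k ord0| <= K * (n%:R * tau).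
  have mn : (m <= n)%N by rewrite -ltnS.
  apply: le_trans (drift _ _ _ tau_ge0 U0E beU m k (leq_trans mn nN)) _.
  by rewrite ler_wpM2l // ler_wpM2r // ler_nat.
have bernoulli (m : 'I_n.+1) : 0 <= 1 - (1 - tau * s) ^+ m <= s * (n%:R * tau).
  have /andP[-> le1] := subr1_exp_le m q01; apply: le_trans le1 _.
  have -> : m%:R * (1 - (1 - tau * s)) = s * (m%:R * tau) by ring.
  by rewrite ler_wpM2l // ler_wpM2r // ler_nat -ltnS.
have dist (m : 'I_n.+1) k :
    `|U m k ord0 - (1 - tau * s) ^+ m * U0 k ord0| <= c k * (n%:R * tau).
  have -> : U m k ord0 - (1 - tau * s) ^+ m * U0 k ord0 =
    (U m k ord0 - U0 k ord0) + (1 - (1 - tau * s) ^+ m) * U0 k ord0 by ring.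
  apply: le_trans (ler_normD _ _) _; rewrite /c [leRHS]mulrDl lerD // normrM.
  have /andP[b0 b1] := bernoulli m.
  by rewrite ger0_norm // [leRHS]mulrAC ler_wpM2r.
rewrite !gramE -sumrB mulr_suml; apply: le_trans (ler_norm_sum _ _ _) _.
apply: ler_sum => k _; rewrite !mxE [leRHS]mulrAC; apply: dist_mul_le => //.
  rewrite normrM ler_wpDr ?mulr_ge0 // ler_piMl // normrX exprn_ile1 //.
  by have /andP[q0 q1] := q01; rewrite ger0_norm.
have -> : U j k ord0 = U0 k ord0 + (U j k ord0 - U0 k ord0) by ring.
apply: le_trans (ler_normD _ _) _; rewrite lerD2l.
by apply: le_trans (driftn j k) _; rewrite ler_wpM2l.
Qed.

Theorem theorem4p1 (R : realType) (d : nat) (D : set 'rV[R]_d) (T : R)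
    (alpha : 'rV[R]_d -> 'M[R]_d) (c : 'rV[R]_d -> R)
    (f : R -> 'rV[R]_d -> R) (u0 : 'rV[R]_d -> R)
    (L r M : nat) (mesh : 'I_L -> 'I_d.+1 -> 'rV[R]_d)
    (node : 'I_M -> 'rV[R]_d) (phi : 'I_M -> 'rV[R]_d -> R)
    (F : 'cV[R]_M)
    (hd : (1 <= d <= 3)%N)
    (hD : bounded_domain D)
    (hT : 0 < T)
    (halpha_sym : forall x, D x -> (alpha x)^T = alpha x)
    (halpha : forall k j, inW1inf D (fun x => alpha x k j))
    (hc : inLinf D c)
    (hf : forall t, 0 < t <= T -> inL2 D (f t))
    (hmesh : simplicial_mesh D mesh)
    (hr : (0 < r)%N)
    (hnode : interior_nodes D mesh r node)
    (hphi : nodal_basis D (fe_space D mesh r) node phi)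
    (hF : forall t, 0 < t <= T -> load_vector D (f t) phi = F)
    (hMass : posdefmx (mass_matrix D phi))
    (hStiff : posdefmx (stiffness_matrix D alpha c phi)) :
  let Mm := mass_matrix D phi in
  let Sm := stiffness_matrix D alpha c phi in
  let A := invsqrtmx Mm *m Sm *m invsqrtmx Mm in
  let U0 : 'cV[R]_M := \col_j interpolant node phi u0 (node j) in
  exists C : R, 0 < C /\
    forall (N : nat) (tau : R) (U : nat -> 'cV[R]_M),
      (0 < N)%N -> tau = T / N%:R -> 0 < tau < 1 ->
      Num.max (tau * spectral_norm A) (spectral_norm (1%:M - tau *: A)) < 1 ->
      U 0%N = U0 -> backward_euler Mm Sm F tau N U ->
      forall n : nat, (n <= N)%N ->
        let X := gram U n in
        let Xstar := gram (fun m => (1 - tau * spectral_norm A) ^+ m *: U0) n in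
        (eigval 0%N X - eigval 0%N Xstar) ^+ 2
          + \sum_(1 <= k < n.+1) eigval k X ^+ 2
        <= C * n%:R ^+ 4 * tau ^+ 2.
Proof.
move=> Mm Sm A U0; set s := spectral_norm A.
have s_ge0 : 0 <= s := spectral_norm_ge0 A.
have [B B_ge0 dev] := gram_deviation F U0 hMass hStiff (ltW hT) s_ge0.
(* [4 * B ^+ 2] is the square of [2 * B], the 2 coming from [n.+1 * n <= 2 * n * n]; the [+ 1] keeps
   the constant positive when [B = 0]. *)
exists (4 * B ^+ 2 + 1); split; first by rewrite ltr_wpDl // mulr_ge0 ?sqr_ge0.
move=> N tau U N_gt0 tauE /andP[/ltW tau_ge0 _].
rewrite gt_max => /andP[/ltW taus _].
move=> U0E beU n nN; cbv zeta.
set X := gram U n; set Xstar := gram _ n.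
have NtauT : N%:R * tau <= T.
  by rewrite tauE mulrCA divff ?mulr1 // pnatr_eq0 -lt0n.
have {dev} := dev _ _ _ tau_ge0 taus NtauT U0E beU _ nN.
rewrite -/Mm -/Sm -/X -/Xstar => dev.
have symX : X^T = X by rewrite /X /gram trmx_mul trmxK.
(* All reference vectors are multiples of [U0], so their Gram matrix is the outer product of the
   coefficients scaled by [|U0|]. *)
pose w : 'cV[R]_n.+1 := \col_i ((1 - tau * s) ^+ i * l2norm U0).
have wE i j : Xstar i j = w i ord0 * w j ord0.
  rewrite gramE !mxE mulrACA -expr2 sqr_sqrtr; last first.
    by apply: sumr_ge0 => k _; exact: sqr_ge0.
  by rewrite mulr_sumr; apply: eq_bigr => k _; rewrite !mxE; ring.
have -> : Xstar = w *m w^T.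
  by apply/matrixP => i j; rewrite wE [RHS]mxE big_ord1 [w^T _ _]mxE.
apply: le_trans (hoffman_wielandt_rank_one w symX) _.
pose e := B * (n%:R * tau).
have entry i j : (X i j - w i ord0 * w j ord0) ^+ 2 <= e ^+ 2.
  rewrite -wE -[leLHS]real_normK ?num_real // ler_pXn2r ?nnegrE ?dev //.
  by rewrite !mulr_ge0.
apply: (@le_trans _ _ (\sum_(i < n.+1) \sum_(j < n.+1) e ^+ 2)).
  by apply: ler_sum => i _; apply: ler_sum => j _.
rewrite !sumr_const !card_ord -mulrnA -[leLHS]mulr_natl natrM.
(* The matrix has [n.+1 ^ 2] entries. Keeping the factor [n] from [e] makes the comparison valid at
   [n = 0], where [n.+1 <= 2 * n] fails. *)
have n2 : n.+1%:R * n%:R <= 2 * n%:R * n%:R :> R.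
  rewrite -!natrM ler_nat; case: (n) => [|m]; first by rewrite muln0.
  by rewrite leq_mul2r mul2n -addnn addnS ltnS leq_addr.
have -> : (4 * B ^+ 2 + 1) * n%:R ^+ 4 * tau ^+ 2 =
    (B * tau * (2 * n%:R * n%:R)) ^+ 2 + n%:R ^+ 4 * tau ^+ 2 by ring.
have -> : n.+1%:R * n.+1%:R * e ^+ 2 = (B * tau * (n.+1%:R * n%:R)) ^+ 2.
  by rewrite /e; ring.
rewrite ler_wpDr ?mulr_ge0 ?exprn_ge0 // ler_pXn2r ?nnegrE ?mulr_ge0 //.
by rewrite ler_wpM2l // mulr_ge0.
Qed.
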